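(* Let $n,m$ be positive integers. Let $B_j$, $B'_j$ be the sequences defined (with parameters $2n$, $2m$ in the roles of the numbers of crossings) in the context, and let $\phi_{2n}^{2m}(x,M)$ be the Riley-Mednykh polynomial of the knot $J(2n,-2m)$. Then, upon identifying $\Lambda=x$, $$B'_{2m+1}+\widetilde{B'_{2m}}\,\widetilde{B_{2n-1}}=\phi_{2n}^{2m}(x,M),$$ that is, $$B'_{2m+1}+\widetilde{B'_{2m}}\,\widetilde{B_{2n-1}}=S_m(z)+\left[-1+x\,S_{n-1}(v)\left(S_n(v)+(1-v)S_{n-1}(v)\right)\right]S_{m-1}(z).$$
   Context: For a rational expression $P$ in $M$ (with coefficients possibly involving $\sqrt{\Lambda}$, regarded as independent of $M$), $\widetilde{P}$ is obtained from $P$ by replacing $M$ with $1/M$. $(B_j)_{j\in\mathbb{Z}}$ is defined by $B_0=0$, $B_1=1$ and $$B_{j+1}=\sqrt{\Lambda}\,B_j+M^{2}B_{j-1}\ (j\text{ odd}),\qquad B_{j+1}=\sqrt{\Lambda}\,B_j+M^{-2}B_{j-1}\ (j\text{ even}).$$ $(B'_j)_{j\in\mathbb{Z}}$ is defined by $B'_0=0$, $B'_1=1$ and $$B'_{j+1}=\left(\widetilde{B_{2n+1}}-\widetilde{B_{2n-1}}\right)B'_j+M^{-2}B'_{j-1}\ (j\text{ odd}),\qquad B'_{j+1}=\left(B_{2n+1}-B_{2n-1}\right)B'_j+M^{2}B'_{j-1}\ (j\text{ even}).$$ The Chebychev polynomials are $S_0(\xi)=1$, $S_1(\xi)=\xi$,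 $S_k(\xi)=\xi S_{k-1}(\xi)-S_{k-2}(\xi)$ for all integers $k$. Put $v=x+M^2+M^{-2}$ and $z=2+(v-2)\,x\,S_{n-1}(v)^2$. The Riley-Mednykh polynomial is $$\phi_{2n}^{2m}(x,M)=S_m(z)+\left[-1+x\,S_{n-1}(v)\left(S_n(v)+(1-v)S_{n-1}(v)\right)\right]S_{m-1}(z).$$ *)

(* Defs.v *)
From HB Require Import structures.
From mathcomp Require Import all_boot all_order all_algebra.

Set Implicit Arguments.
Unset Strict Implicit.
Unset Printing Implicit Defensive.

Import GRing.Theory.
Local Open Scope ring_scope.
Local Open Scope quotient_scope.

Local Notation "x %:F" := (@FracField.tofrac _ x).

(* The sequence (u_j), j : int, with initial values u_0 and u_1 and
     u_{j+1} = a_j u_j + b_j u_{j-1}     for all j : int.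
   The recurrence is run forwards for j > 1, and backwards for j < 0, where the
   b_j must be units; birecP is the recurrence itself. *)
Section TwoSidedRecurrence.
Variables (R : comUnitRingType) (a b : int -> R) (u0 u1 : R).

(* birec_fwd k = (u_k, u_{k+1}) *)
Definition birec_fwd (k : nat) : R * R :=
  iteri k (fun i p => (p.2, a i.+1%:Z * p.2 + b i.+1%:Z * p.1)) (u0, u1).

(* birec_bwd k = (u_{-k}, u_{-k+1}) *)
Definition birec_bwd (k : nat) : R * R :=
  iteri k (fun i p => ((b (- i%:Z))^-1 * (p.2 - a (- i%:Z) * p.1), p.1))
    (u0, u1).

Definition birec (j : int) : R :=
  match j with
  | Posz k => (birec_fwd k).1
  | Negz k => (birec_bwd k.+1).1
  end.

Lemma birec0 : birec 0 = u0. Proof. by []. Qed.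

Lemma birec1 : birec 1 = u1. Proof. by []. Qed.

Lemma birecP (j : int) : b j \is a GRing.unit ->
  birec (j + 1) = a j * birec j + b j * birec (j - 1).
Proof.
have bwdE k : birec (- k%:Z) = (birec_bwd k).1 by case: k.
have bwd2 k : (birec_bwd k).2 = birec (1 - k%:Z).
  case: k => [|k] //.
  by rewrite -addn1 PoszD opprD addrCA subrr addr0 bwdE addn1.
case: (intP j) => [|k|k] ub.
- by rewrite add0r sub0r bwdE /= oppr0 mulVKr // addrC subrK.
- have -> : k.+1%:Z - 1 = k by rewrite -addn1 PoszD addrK.
  by rewrite -PoszD addn1.
have -> : - k.+1%:Z - 1 = - k.+2%:Z.
  by rewrite -opprD -PoszD addn1.
rewrite addrC -bwd2 !bwdE.
have -> : (birec_bwd k.+2).1 = (b (- k.+1%:Z))^-1 *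
    ((birec_bwd k.+1).2 - a (- k.+1%:Z) * (birec_bwd k.+1).1) by [].
by rewrite mulVKr // addrC subrK.
Qed.

End TwoSidedRecurrence.

(* Rational expressions in M over a coefficient field K containing the square
   root of Lambda are elements of K(M); everything in K is independent of M.
   For instance K = C(sqrt Lambda) with sqrt Lambda an indeterminate. *)
Section RationalExpressions.
Variable K : fieldType.

Definition ratcst (c : K) : {fraction {poly K}} := (c%:P)%:F.

Definition Mvar : {fraction {poly K}} := ('X : {poly K})%:F.

HB.instance Definition _ := GRing.RMorphism.copy ratcst
  (@FracField.tofrac {poly K} \o polyC).

(* p(M) |-> p(1/M) on polynomials in M *)
Definition poly_at_invM (p : {poly K}) : {fraction {poly K}} :=
  (map_poly ratcst p).[Mvar^-1].

HB.instance Definition _ := GRing.RMorphism.copy poly_at_invM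
  (horner_eval Mvar^-1 \o map_poly ratcst).

(* P(M) |-> P(1/M), computed on a representative p/q of P; tilde_frac shows
   that the choice of the representative does not matter. *)
Definition tilde (P : {fraction {poly K}}) : {fraction {poly K}} :=
  poly_at_invM \n_(repr P) / poly_at_invM \d_(repr P).

Lemma poly_at_invM_neq0 (q : {poly K}) : q != 0 -> poly_at_invM q != 0.
Proof.
move=> q0; have X0 : Mvar != 0 by rewrite tofrac_eq0 polyX_eq0.
have sq : (0 < size q)%N by rewrite size_poly_gt0.
pose r : {poly K} := \poly_(i < size q) q`_((size q).-1 - i).
have r0 : r != 0.
  apply/eqP => /(congr1 (coefp 0%N)) /eqP.
  rewrite /= coef_poly sq subn0 coef0.
  by rewrite -/(lead_coef q) lead_coef_eq0 (negPf q0).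
suff E : poly_at_invM q * Mvar ^+ (size q).-1 = r%:F.
  apply: contraNneq r0 => z; move: E; rewrite z mul0r => /esym/eqP.
  by rewrite tofrac_eq0.
rewrite /poly_at_invM horner_coef size_map_poly mulr_suml.
rewrite /r [in RHS]poly_def.
rewrite rmorph_sum (reindex_inj rev_ord_inj) /=.
apply: eq_bigr => i _.
have le_i : (i <= (size q).-1)%N by rewrite -ltnS prednK.
have -> : (size q - i.+1 = (size q).-1 - i)%N by rewrite -subn1 -subnDA add1n.
rewrite coef_map -mul_polyC rmorphM rmorphXn /= -/(ratcst _) -/Mvar -mulrA.
congr (_ * _); rewrite -{2}(subnK le_i) exprD mulrA -exprMn mulVf //.
by rewrite expr1n mul1r.
Qed.

Lemma tilde_frac (p q : {poly K}) : q != 0 ->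
  tilde (p%:F / q%:F) = poly_at_invM p / poly_at_invM q.
Proof.
move=> q0; set P := _ / _; rewrite /tilde.
set d := \d_(repr P); set c := \n_(repr P).
have d0 : d != 0 by exact: denom_ratioP.
have PE : P = c%:F / d%:F.
  rewrite -[LHS]reprK /c /d; move: (repr P) => r.
  unlock FracField.tofrac.
  rewrite -[X in _ * X]FracField.pi_inv -[RHS]FracField.pi_mul.
  rewrite /FracField.mulf /FracField.invf.
  rewrite !numden_Ratio ?(oner_neq0, mul1r, mulr1) ?denom_ratioP //.
  by rewrite Ratio_numden.
have : c * q = p * d.
  apply/eqP; rewrite -tofrac_eq !rmorphM /= -eqr_div ?tofrac_eq0 //.
  by rewrite -PE.
move/(congr1 poly_at_invM); rewrite !rmorphM /= => E.
by apply/eqP; rewrite eqr_div ?poly_at_invM_neq0 // E.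
Qed.

End RationalExpressions.

Section Sequences.
Variables (K : fieldType) (sqrtL : K).
Local Notation KM := {fraction {poly K}}.
Local Notation M := (Mvar K).

(* sqrtL stands for the square root of Lambda. *)
Definition B : int -> KM :=
  birec (fun=> ratcst sqrtL)
        (fun j => if odd `|j| then M ^+ 2 else M ^- 2) 0 1.

Definition B' (n : nat) : int -> KM :=
  birec (fun j => if odd `|j|
                  then tilde (B (2 * n%:Z + 1)) - tilde (B (2 * n%:Z - 1))
                  else B (2 * n%:Z + 1) - B (2 * n%:Z - 1))
        (fun j => if odd `|j| then M ^- 2 else M ^+ 2) 0 1.

Lemma Mvar_unit : M \is a GRing.unit.
Proof. by rewrite unitfE tofrac_eq0 polyX_eq0. Qed.

Lemma B_rec (j : int) :
  B (j + 1) = if odd `|j| then ratcst sqrtL * B j + M ^+ 2 * B (j - 1)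
              else ratcst sqrtL * B j + M ^- 2 * B (j - 1).
Proof.
rewrite /B birecP; first by case: ifP.
by case: ifP => _; rewrite ?unitrV unitrX // Mvar_unit.
Qed.

Lemma B'_rec (n : nat) (j : int) :
  B' n (j + 1) =
    if odd `|j|
    then (tilde (B (2 * n%:Z + 1)) - tilde (B (2 * n%:Z - 1))) * B' n j
         + M ^- 2 * B' n (j - 1)
    else (B (2 * n%:Z + 1) - B (2 * n%:Z - 1)) * B' n j
         + M ^+ 2 * B' n (j - 1).
Proof.
rewrite {1}/B' birecP; first by case: ifP.
by case: ifP => _; rewrite ?unitrV unitrX // Mvar_unit.
Qed.

End Sequences.

Section Chebyshev.
Variable F : fieldType.

Definition chebS : int -> {poly F} := birec (fun=> 'X) (fun=> -1) 1 'X.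

Lemma chebS_rec (k : int) : chebS k = 'X * chebS (k - 1) - chebS (k - 2).
Proof.
have := @birecP {poly F} (fun=> 'X) (fun=> -1) 1 'X (k - 1).
rewrite unitrN1 subrK mulN1r -addrA -opprD; exact.
Qed.

Definition vRM (x M : F) : F := x + M ^+ 2 + M ^- 2.

Definition zRM (n : nat) (x M : F) : F :=
  2 + (vRM x M - 2) * x * (chebS (n%:Z - 1)).[vRM x M] ^+ 2.

(* phi n m x M is the Riley-Mednykh polynomial phi_{2n}^{2m}(x, M) of
   J(2n, -2m). *)
Definition phi (n m : nat) (x M : F) : F :=
  let v := vRM x M in
  let z := zRM n x M in
  (chebS m).[z]
  + (- 1 + x * (chebS (n%:Z - 1)).[v]
             * ((chebS n).[v] + (1 - v) * (chebS (n%:Z - 1)).[v]))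
    * (chebS (m%:Z - 1)).[z].

End Chebyshev.

(* Main.v *)
Require Import Defs.
From HB Require Import structures.
From mathcomp Require Import all_boot all_order all_algebra.
From mathcomp Require Import ring.

Set Implicit Arguments.
Unset Strict Implicit.
Unset Printing Implicit Defensive.

Import GRing.Theory.
Local Open Scope ring_scope.

(** Two steps of either recurrence are a single linear map, whose matrix has
    determinant 1 because the two coefficients of the older term, M^2 and M^-2
    in either order, are inverse to each other; so every second term of the
    sequence obeys a Chebyshev recurrence in the trace y of that map.
    Concretely ([alternating_recE]), if c, d are the alternating coefficients
    of the newer term and b, 1/b those of the older one, then with
    y = c d + b + 1/b
      u_{2k} = c S_{k-1}(y)   and   u_{2k+1} = S_k(y) - b S_{k-1}(y).

    For B the trace is v, so B_{2k+1} = S_k(v) - M^2 S_{k-1}(v).  For B' put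
    D = B_{2n+1} - B_{2n-1}; the trace is D tilde(D) + M^2 + M^-2.  The
    substitution of 1/M for M is a field endomorphism fixing v and z, so
    tilde(D) is explicit as well, and the left-hand side of the theorem is
      S_m(y) + (- M^-2 + D tilde(B_{2n-1})) S_{m-1}(y)
    where y is this trace.
    It remains to compare y with z and the coefficient of S_{m-1} with the one
    in the Riley-Mednykh polynomial.  Both are identities between polynomials
    in S_{n-1}(v) and S_{n-2}(v) that hold modulo
      S_{n-1}(v)^2 + S_{n-2}(v)^2 - v S_{n-1}(v) S_{n-2}(v) = 1,
    the invariant of the Chebyshev recurrence ([chebS_norm],
    [trace_and_coefficient_identities]). *)

(** * Chebyshev polynomials and recurrences with alternating coefficients *)

Section ChebyshevValues.
Variable F : fieldType.
Implicit Types (k : int) (y : F).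

Lemma horner_chebS_rec k y :
  (chebS F (k + 1)).[y] = y * (chebS F k).[y] - (chebS F (k - 1)).[y].
Proof.
have -> : k - 1 = k + 1 - 2 by ring.
by rewrite chebS_rec addrK !hornerE.
Qed.

Lemma horner_chebS_recN k y :
  (chebS F (k - 1)).[y] = y * (chebS F k).[y] - (chebS F (k + 1)).[y].
Proof. by rewrite horner_chebS_rec; ring. Qed.

Lemma horner_chebS0 y : (chebS F 0).[y] = 1.
Proof. by rewrite /chebS birec0 hornerE. Qed.

Lemma horner_chebSN1 y : (chebS F (-1)).[y] = 0.
Proof.
rewrite -[-1]add0r horner_chebS_recN horner_chebS0 add0r.
by rewrite /chebS birec1 hornerX mulr1 subrr.
Qed.

(** The backward step is asked from every integer, and not only from the
    nonpositive ones as in [int_rect]: for a two-sided recurrence both steps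
    are available everywhere. *)
Lemma int_step_ind (P : int -> Prop) :
  P 0 -> (forall k, P k -> P (k + 1)) -> (forall k, P k -> P (k - 1)) ->
  forall k, P k.
Proof.
move=> P0 PS PP; elim/int_rect => [|k|k] //.
  by move/PS; rewrite -PoszD addn1.
by move/PP; rewrite -opprD -PoszD addn1.
Qed.

(** The quadratic form is invariant under the determinant-one map
    (p, q) |-> (y p - q, p), and equals 1 at (S_0, S_{-1}) = (1, 0). *)
Lemma chebS_norm k y :
  (chebS F k).[y] ^+ 2 + (chebS F (k - 1)).[y] ^+ 2
    - y * (chebS F k).[y] * (chebS F (k - 1)).[y] = 1.
Proof.
elim/int_step_ind: k => [|k IH|k IH].
- by rewrite sub0r horner_chebS0 horner_chebSN1; ring.
- by rewrite addrK horner_chebS_rec -[RHS]IH; ring.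
by rewrite (horner_chebS_recN (k - 1)) subrK -[RHS]IH; ring.
Qed.

(** The step matrices have determinants - b and - 1/b, so the matrix of two
    steps has determinant 1; its trace is y.  As b is invertible, a pair of
    consecutive terms determines both its neighbours, and the formulas hold at
    all integers. *)
Lemma alternating_recE (u : int -> F) (c d b : F) :
  b != 0 -> u 0 = 0 -> u 1 = 1 ->
  (forall j, u (j + 1) = if odd `|j| then c * u j + b * u (j - 1)
                         else d * u j + b^-1 * u (j - 1)) ->
  let y := c * d + b + b^-1 in
  forall k, u (2 * k) = c * (chebS F (k - 1)).[y]
    /\ u (2 * k + 1) = (chebS F k).[y] - b * (chebS F (k - 1)).[y].
Proof.
move=> b0 u0 u1 uP y.
have odd2 k : odd `|2 * k| = false by rewrite abszM oddM.
have odd2S k : odd `|2 * k + 1| = true.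
  case: k => k; first by rewrite -PoszM -PoszD addn1 /= oddM.
  have -> : 2 * Negz k + 1 = - (2 * k + 1)%N%:Z.
    by rewrite NegzE PoszD PoszM -addn1 PoszD; ring.
  by rewrite abszN addn1 /= oddM.
have u_even k : u (2 * (k + 1)) = c * u (2 * k + 1) + b * u (2 * k).
  have -> : 2 * (k + 1) = (2 * k + 1) + 1 by ring.
  by rewrite uP odd2S addrK.
have u_odd k : u (2 * k + 1) = d * u (2 * k) + b^-1 * u (2 * (k - 1) + 1).
  have -> : 2 * (k - 1) + 1 = 2 * k - 1 by ring.
  by rewrite uP odd2.
elim/int_step_ind => [|k [IHe IHo]|k [IHe IHo]].
- by rewrite mulr0 sub0r add0r u0 u1 horner_chebS0 horner_chebSN1 !mulr0 subr0.
- have E : u (2 * (k + 1)) = c * (chebS F k).[y].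
    by rewrite u_even IHe IHo; ring.
  rewrite addrK; split=> //.
  by rewrite u_odd addrK E IHo horner_chebS_rec /y; field.
have S_k := horner_chebS_recN (k - 1) y; rewrite subrK in S_k.
have E : u (2 * (k - 1) + 1)
    = (chebS F (k - 1)).[y] - b * (chebS F (k - 1 - 1)).[y].
  apply: (mulfI (invr_neq0 b0)); apply: (addrI (d * u (2 * k))).
  by rewrite -u_odd IHe IHo S_k /y; field.
split=> //.
apply: (mulfI b0); apply: (addrI (c * u (2 * (k - 1) + 1))).
by rewrite -u_even subrK IHe E; ring.
Qed.

(** In the application mu = M^2, a = S_{n-1}(v) and b = S_{n-2}(v), so that
    v a - b = S_n(v), while D = B_{2n+1} - B_{2n-1} and D' is its image under
    M |-> 1/M. *)
Lemma trace_and_coefficient_identities (x mu a b : F) : mu != 0 ->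
  let v := x + mu + mu^-1 in
  let D := v * a - b - a - mu * (a - b) in
  let D' := v * a - b - a - mu^-1 * (a - b) in
  a ^+ 2 + b ^+ 2 - v * a * b = 1 ->
  D' * D + mu^-1 + mu = 2 + (v - 2) * x * a ^+ 2
  /\ - mu^-1 + D * (a - mu^-1 * b)
     = - 1 + x * a * ((v * a - b) + (1 - v) * a).
Proof.
move=> mu0 v D D' ab1; split.
  (* The multiplier of the relation is the coefficient of b ^+ 2 in D' * D. *)
  transitivity (2 + (v - 2) * x * a ^+ 2
    + (2 - mu - mu^-1) * (a ^+ 2 + b ^+ 2 - v * a * b - 1)).
    by rewrite /D /D' /v; field.
  by rewrite ab1; ring.
(* The multiplier of the relation is the coefficient of b ^+ 2 in
   D * (a - mu^-1 * b). *)
transitivity (- 1 + x * a * ((v * a - b) + (1 - v) * a)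
  + (mu^-1 - 1) * (a ^+ 2 + b ^+ 2 - v * a * b - 1)).
  by rewrite /D /v; field.
by rewrite ab1; ring.
Qed.

End ChebyshevValues.

Lemma horner_chebS_morph (F G : fieldType) (f : {rmorphism F -> G}) k y :
  f (chebS F k).[y] = (chebS G k).[f y].
Proof.
suff [] : f (chebS F k).[y] = (chebS G k).[f y]
  /\ f (chebS F (k - 1)).[y] = (chebS G (k - 1)).[f y] by [].
elim/int_step_ind: k => [|k [IH1 IH2]|k [IH1 IH2]].
- by rewrite sub0r !horner_chebS0 !horner_chebSN1 rmorph0 rmorph1.
- by rewrite addrK !horner_chebS_rec rmorphB rmorphM IH1 IH2.
split=> //.
by rewrite !(horner_chebS_recN (k - 1)) subrK rmorphB rmorphM IH1 IH2.
Qed.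

(** * Substituting 1/M for M is a ring morphism *)

Section Tilde.
Variable K : fieldType.
Local Notation KM := {fraction {poly K}}.
Local Notation M := (Mvar K).
Local Notation "p %:F" := (@FracField.tofrac {poly K} p).
Local Open Scope quotient_scope.

Lemma fraction_num_den (P : KM) : exists p q, q != 0 /\ P = p%:F / q%:F.
Proof.
exists \n_(repr P), \d_(repr P); split; first exact: denom_ratioP.
rewrite -[LHS]reprK; move: (repr P) => r.
unlock FracField.tofrac.
rewrite -[X in _ * X]FracField.pi_inv -[RHS]FracField.pi_mul.
rewrite /FracField.mulf /FracField.invf.
rewrite !numden_Ratio ?(oner_neq0, mul1r, mulr1) ?denom_ratioP //.
by rewrite Ratio_numden.
Qed.

Lemma tilde_tofrac p : tilde p%:F = poly_at_invM p.
Proof.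
by rewrite -[p%:F]divr1 -tofrac1 tilde_frac ?oner_neq0 // rmorph1 divr1.
Qed.

Lemma tilde_monoid_morphism : monoid_morphism (@tilde K).
Proof.
split=> [|P Q]; first by rewrite -tofrac1 tilde_tofrac rmorph1.
have [p [q [q0 ->]]] := fraction_num_den P.
have [r [s [s0 ->]]] := fraction_num_den Q.
by rewrite mulf_div -!tofracM !tilde_frac ?mulf_neq0 // !rmorphM mulf_div.
Qed.

Lemma tilde_zmod_morphism : zmod_morphism (@tilde K).
Proof.
move=> P Q.
have [p [q [q0 ->]]] := fraction_num_den P.
have [r [s [s0 ->]]] := fraction_num_den Q.
rewrite -mulNr -tofracN addf_div ?tofrac_eq0 // -!tofracM -tofracD.
rewrite !tilde_frac ?mulf_neq0 // -mulNr addf_div ?poly_at_invM_neq0 //.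
by rewrite rmorphD !rmorphM rmorphN.
Qed.

HB.instance Definition _ :=
  GRing.isZmodMorphism.Build KM KM (@tilde K) tilde_zmod_morphism.
HB.instance Definition _ :=
  GRing.isMonoidMorphism.Build KM KM (@tilde K) tilde_monoid_morphism.

Lemma tildeB P Q : tilde (P - Q) = tilde P - tilde Q :> KM.
Proof. exact: rmorphB. Qed.

Lemma tilde_ratcst (c : K) : tilde (ratcst c) = ratcst c.
Proof. by rewrite tilde_tofrac /poly_at_invM map_polyC hornerC. Qed.

Lemma tilde_Mvar : tilde M = M^-1.
Proof. by rewrite tilde_tofrac /poly_at_invM map_polyX hornerX. Qed.

Lemma tilde_vRM (x : K) : tilde (vRM (ratcst x) M) = vRM (ratcst x) M.
Proof.
by rewrite /vRM !rmorphD fmorphV !rmorphXn /= tilde_ratcst tilde_Mvar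
  exprVn invrK addrAC.
Qed.

(** * Closed forms of the two sequences *)

Section Sequences.
Variables (s L : K).
Hypothesis sqr_s : s ^+ 2 = L.
Local Notation x := (ratcst L).
Local Notation v := (vRM x M).

Lemma Mvar2_neq0 : M ^+ 2 != 0.
Proof. by rewrite expf_neq0 // tofrac_eq0 polyX_eq0. Qed.

(** Here c = d = s and b = M^2, hence c d + b + 1/b = v. *)
Lemma B_odd k :
  B s (2 * k + 1) = (chebS KM k).[v] - M ^+ 2 * (chebS KM (k - 1)).[v].
Proof.
have [//|//|_] := alternating_recE Mvar2_neq0 _ _ (B_rec s) k.
by rewrite -expr2 -rmorphXn /= sqr_s.
Qed.

Lemma tilde_B_odd k :
  tilde (B s (2 * k + 1))
  = (chebS KM k).[v] - M ^- 2 * (chebS KM (k - 1)).[v].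
Proof.
rewrite B_odd rmorphB rmorphM rmorphXn /= !horner_chebS_morph /=.
by rewrite tilde_Mvar tilde_vRM exprVn.
Qed.

Section Outer.
Variable n : nat.
Local Notation D := (B s (2 * n%:Z + 1) - B s (2 * n%:Z - 1)).
Local Notation z := (zRM n x M).
Local Notation a := (chebS KM (n%:Z - 1)).[v].
Local Notation b := (chebS KM (n%:Z - 1 - 1)).[v].

Let sub1E : 2 * n%:Z - 1 = 2 * (n%:Z - 1) + 1.
Proof. by ring. Qed.

Let chebS_n : (chebS KM n).[v] = v * a - b.
Proof. by rewrite -horner_chebS_rec subrK. Qed.

Lemma D_E : D = v * a - b - a - M ^+ 2 * (a - b).
Proof. by rewrite sub1E !B_odd chebS_n; ring. Qed.

Lemma tilde_D_E : tilde D = v * a - b - a - M ^- 2 * (a - b).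
Proof. by rewrite tildeB sub1E !tilde_B_odd chebS_n; ring. Qed.

Lemma B'_trace_and_coefficient :
  tilde D * D + M ^- 2 + M ^+ 2 = z
  /\ - M ^- 2 + D * tilde (B s (2 * n%:Z - 1))
     = - 1 + x * a * ((chebS KM n).[v] + (1 - v) * a).
Proof.
rewrite tilde_D_E D_E sub1E tilde_B_odd chebS_n.
exact: (trace_and_coefficient_identities Mvar2_neq0 (chebS_norm (n%:Z - 1) v)).
Qed.

(** Here c = tilde D, d = D and b = M^-2, and the trace is z by
    [B'_trace_and_coefficient]. *)
Lemma B'_E k :
  B' s n (2 * k) = tilde D * (chebS KM (k - 1)).[z]
  /\ B' s n (2 * k + 1) = (chebS KM k).[z] - M ^- 2 * (chebS KM (k - 1)).[z].
Proof.
have rec j : B' s n (j + 1) = if odd `|j|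
    then tilde D * B' s n j + M ^- 2 * B' s n (j - 1)
    else D * B' s n j + (M ^- 2)^-1 * B' s n (j - 1).
  by rewrite B'_rec invrK tildeB.
have := alternating_recE (invr_neq0 Mvar2_neq0) _ _ rec k.
by rewrite invrK B'_trace_and_coefficient.1; apply.
Qed.

Lemma tilde_z : tilde z = z.
Proof.
rewrite /zRM rmorphD rmorphMn rmorph1 !rmorphM rmorphB -expr2 rmorphMn /=.
by rewrite rmorph1 horner_chebS_morph /= tilde_vRM tilde_ratcst.
Qed.

(** Needed because the theorem applies tilde to B'_{2m}, whose closed form
    already has the factor tilde D. *)
Lemma tildeK_D : tilde (tilde D) = D.
Proof.
by rewrite tilde_D_E D_E !rmorphB !rmorphM !rmorphB fmorphV rmorphXn /=
  !horner_chebS_morph /= tilde_vRM tilde_Mvar exprVn invrK.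
Qed.

End Outer.
End Sequences.
End Tilde.

Theorem mainTheorem3 (K : fieldType) (Lambda sqrtL x : K) (n m : nat)
    (hn : (0 < n)%N) (hm : (0 < m)%N)
    (hsqrt : sqrtL ^+ 2 = Lambda) (hx : Lambda = x) :
  B' sqrtL n (2 * m%:Z + 1)
    + tilde (B' sqrtL n (2 * m%:Z)) * tilde (B sqrtL (2 * n%:Z - 1))
  = phi n m (ratcst x) (Mvar K).
Proof.
rewrite -hx.
have [-> ->] := B'_E hsqrt n m.
rewrite rmorphM /= horner_chebS_morph /= (tildeK_D hsqrt) tilde_z.
rewrite /phi /= -(B'_trace_and_coefficient hsqrt n).2.
by ring.
Qed.
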